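(* Let $a<b$ be real numbers and let $n$ be a positive integer. Assume that $f\in U_{n,[a,b]}$. Then $g_n(x):=(f(b)-f(x))^{1/n}$ is convex on $[a,b]$ if and only if $k_n(x):=-f(b-x^{1/n})$ is convex on $[0,(b-a)^n]$.
   Context: $C^{m}([a,b])$ is the set of $m$ times continuously differentiable functions $u:[a,b]\to\mathbb{R}$ (one-sided derivatives at the endpoints); $u^{(k)}$ is the $k$-th derivative. For a positive integer $n$ and $a<b$, $$U_{n,[a,b]} := \{u \in C^{n+1}([a,b]) : (-1)^{k}u^{(k)}(x) \le 0 \ \ \forall x\in[a,b],\ \forall k=1,\dots,n+1\}.$$ *)

(* Defs.v *)
(* Real analysis over an abstract realType, in MathComp-Analysis. *)
From mathcomp Require Import all_boot all_order all_algebra.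
From mathcomp Require Import all_classical all_reals all_analysis.
Import Order.TTheory GRing.Theory Num.Theory.
Import numFieldNormedType.Exports.

Set Implicit Arguments.
Unset Strict Implicit.
Unset Printing Implicit Defensive.

Local Open Scope classical_set_scope.
Local Open Scope ring_scope.

(* A function on [a, b] is represented by a total function R -> R; nothing
   below looks at its values outside [a, b].  The difference quotient is taken
   along y -> x with y != x and y in [a, b], so its limit is the two-sided
   derivative on ]a, b[ and the one-sided derivative at a and at b. *)
Definition diff_quot_itv (R : realType) (a b : R) (u : R -> R) (x : R) :
    set_system R :=
  (u y - u x) / (y - x) @[y --> within `[a, b] x^'].

Definition derivable_itv (R : realType) (a b : R) (u : R -> R) (x : R) : Prop :=
  cvg (diff_quot_itv a b u x).

Definition derive_itv (R : realType) (a b : R) (u : R -> R) (x : R) : R :=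
  lim (diff_quot_itv a b u x).

Definition derive_itvn (R : realType) (a b : R) (k : nat) (u : R -> R) : R -> R :=
  iter k (derive_itv a b) u.

Definition Cm_itv (R : realType) (m : nat) (a b : R) : set (R -> R) :=
  [set u | (forall k : nat, (k < m)%N -> forall x : R, x \in `[a, b] ->
              derivable_itv a b (derive_itvn a b k u) x) /\
           {within `[a, b], continuous (derive_itvn a b m u)}].

Definition U_itv (R : realType) (n : nat) (a b : R) : set (R -> R) :=
  [set u | Cm_itv n.+1 a b u /\
           forall x : R, x \in `[a, b] ->
           forall k : nat, (1 <= k <= n.+1)%N ->
             (-1) ^+ k * derive_itvn a b k u x <= 0].

(* Main.v *)
(* Put h t = f b - f (b - t) on [0, b - a]; then h 0 = 0 and h, h', ..., h^(n+1)
   are all nonnegative.  Both convexity properties are equivalent to h being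
   flat at 0, i.e. to h^(k) 0 = 0 for k < n.
   Either convexity, used on the chord issued from 0, gives h t <= C t^n, while
   Taylor's lower bound gives h^(k)(0) t^k / k! <= h t; letting t -> 0 yields
   flatness.
   Conversely let h be flat.  That h (x^(1/n)) and h^(1/n) are convex means that
   h lies, between two points, below the interpolating functions
   alpha t^n + beta and (sigma (t - r))^n respectively.  If this failed, the
   difference F would change sign there; by the mean value theorem the sign
   pattern passes from F^(k) to F^(k+1), until it contradicts the monotonicity
   of F^(n), which is h^(n) minus a constant. *)

Require Import Defs.
From mathcomp Require Import all_boot all_order all_algebra.
From mathcomp Require Import all_classical all_reals all_analysis.
From mathcomp Require Import ring lra.

Set Implicit Arguments.
Unset Strict Implicit.
Unset Printing Implicit Defensive.

Import Order.TTheory GRing.Theory Num.Theory.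
Import numFieldNormedType.Exports.
Local Open Scope classical_set_scope.
Local Open Scope ring_scope.

(** * Derivatives restricted to a closed interval, against ordinary ones *)

Lemma derivable_itv_continuous (R : realType) (a b : R) (u : R -> R) (x : R) :
  derivable_itv a b u x ->
  u y @[y --> within `[a, b] (nbhs x)] --> u x.
Proof.
move=> du.
have u_punctured : u y @[y --> within `[a, b] x^'] --> u x.
  have quotK : (u y - u x) / (y - x) * (y - x) + u x
      @[y --> within `[a, b] x^'] --> derive_itv a b u x * (x - x) + u x.
    apply: cvgD; last exact: cvg_cst.
    apply: cvgM; first exact: du.
    apply: cvgB; last exact: cvg_cst.
    by move=> A /= Ax; apply: filterS Ax => y Ay _ _; exact: Ay.
  rewrite subrr mulr0 add0r in quotK.
  apply: cvg_trans quotK; apply: near_eq_cvg.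
  near=> y; rewrite mulfVK ?subrK// subr_eq0.
  by near: y; apply: (cvg_within _ (nbhs_dnbhs_neq x)).
move=> A Aux; have := u_punctured A Aux.
(* The two filters differ only in whether [y = x] is allowed, and there membership in [A] is
   immediate. *)
change (nbhs x (fun y => y != x -> `[a, b]%classic y -> A (u y)) ->
        nbhs x (fun y => `[a, b]%classic y -> A (u y))).
apply: filterS => y uy yab.
have [->|yx] := eqVneq y x; first exact: nbhs_singleton Aux.
exact: uy.
Unshelve. all: by end_near. Qed.

(** Near an interior point the constraint to [[a, b]] holds on a whole neighbourhood, so the
    restricted difference quotient has the ordinary limit. *)
Lemma derivable_itv_is_derive (R : realType) (a b : R) (u : R -> R) (x : R) :
  x \in `]a, b[ -> derivable_itv a b u x ->
  is_derive x 1 u (derive_itv a b u x).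
Proof.
move=> xab du.
have shift_within : h + x @[h --> 0^'] --> within `[a, b] x^'.
  move=> A /= Ax.
  have nA : nbhs x (fun y => y != x -> A y).
    have Ax' : nbhs x (fun y => y != x -> `[a, b]%classic y -> A y) := Ax.
    apply: filterS2 (near_in_itvoo xab) Ax' => y yab Ay /Ay; apply.
    exact: subset_itv_oo_cc yab.
  change (nbhs 0 (fun h => h != 0 -> A (h + x))).
  have sx : h + x @[h --> 0] --> x.
    by rewrite -{2}[x]add0r; apply: cvgD; [exact: cvg_id|exact: cvg_cst].
  apply: (@filterS _ (nbhs (0 : R)) _ _ _ _ (sx _ nA)) => h /= Ah h0.
  by apply: Ah; rewrite -subr_eq0 addrK.
have quot_cvg :
    h^-1 *: ((u \o shift x) (h *: 1) - u x) @[h --> 0^'] --> derive_itv a b u x.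
  apply: cvg_trans (cvg_comp _ _ shift_within du).
  apply: near_eq_cvg; near=> h => /=.
  by rewrite addrK /GRing.scale /= mulr1 mulrC.
by apply: DeriveDef; [apply/cvg_ex; eexists; exact: quot_cvg|exact: cvg_lim].
Unshelve. all: by end_near. Qed.

(** * Families of successive derivatives and the propagation of signs *)

(** [F k] stands for the k-th derivative, with just the regularity that the mean value theorem asks
    for. Being indexed by a family, the notion passes to the shift [fun k => F k.+1], on which the
    inductions below run. *)
Definition deriv_tower (R : realType) (n : nat) (a b : R)
    (F : nat -> R -> R) : Prop :=
  forall k, (k < n)%N -> {within `[a, b], continuous (F k)} /\
    forall x, x \in `]a, b[ -> is_derive x 1 (F k) (F k.+1 x).

Lemma deriv_tower_MVT (R : realType) (n k : nat) (a b x y : R)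
    (F : nat -> R -> R) :
  deriv_tower n a b F -> (k < n)%N -> a <= x -> x < y -> y <= b ->
  exists c, [/\ x < c, c < y & F k y - F k x = F k.+1 c * (y - x)].
Proof.
move=> tF kn ax xy yb; have [Fc Fd] := tF _ kn.
have Fd' z : z \in `]x, y[ -> is_derive z 1 (F k) (F k.+1 z).
  rewrite in_itv/= => /andP[xz zy]; apply: Fd.
  by rewrite in_itv/= (le_lt_trans ax xz) (lt_le_trans zy yb).
have Fc' : {within `[x, y], continuous (F k)}.
  apply: continuous_subspaceW Fc => z /=; rewrite !in_itv/= => /andP[xz zy].
  by rewrite (le_trans ax xz) (le_trans zy yb).
have [c] := MVT xy Fd' Fc'.
by rewrite in_itv/= => /andP[xc cy] E; exists c; split.
Qed.

Lemma deriv_tower_itvW (R : realType) (n : nat) (a b c d : R)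
    (F : nat -> R -> R) :
  a <= c -> d <= b -> deriv_tower n a b F -> deriv_tower n c d F.
Proof.
move=> ac db tF k /tF[Fc Fd]; split=> [|x].
  apply: continuous_subspaceW Fc => z /=; rewrite !in_itv/= => /andP[cz zd].
  by rewrite (le_trans ac cz) (le_trans zd db).
rewrite in_itv/= => /andP[cx xd]; apply: Fd.
by rewrite in_itv/= (le_lt_trans ac cx) (lt_le_trans xd db).
Qed.

Lemma deriv_tower_sub (R : realType) (n : nat) (a b : R)
    (F G : nat -> R -> R) :
  deriv_tower n a b F -> deriv_tower n a b G ->
  deriv_tower n a b (fun k x => F k x - G k x).
Proof.
move=> tF tG k kn; have [Fc Fd] := tF _ kn; have [Gc Gd] := tG _ kn.
split=> [|x xab]; first exact: within_continuousB.
have := Fd _ xab; have := Gd _ xab => ? ?; exact: is_deriveB.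
Qed.

(** These are the derivatives of [c * (x - r) ^+ n]. Beyond order [n] the falling factorial is 0, so
    the truncated exponent [n - k] is harmless and [m] can be arbitrary. *)
Lemma deriv_tower_pow (R : realType) (m n : nat) (a b c r : R) :
  deriv_tower m a b (fun k x => c * (n ^_ k)%:R * (x - r) ^+ (n - k)).
Proof.
move=> k _.
have pd (x : R) : is_derive x 1
    (fun x => c * (n ^_ k)%:R * (x - r) ^+ (n - k))
    (c * (n ^_ k.+1)%:R * (x - r) ^+ (n - k.+1)).
  have -> : (fun x => c * (n ^_ k)%:R * (x - r) ^+ (n - k)) =
      (c * (n ^_ k)%:R) \*: ((fun x : R => x - r) ^+ (n - k)).
    by apply/funext => y; rewrite !fctE.
  have shift_d : is_derive x 1 (fun x : R => x - r) (1 - 0).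
    by apply: is_deriveB.
  rewrite subr0 in shift_d.
  apply: is_derive_eq; rewrite /GRing.scale /= mulr1 ffactnSr natrM subnS.
  by ring.
split=> [|x _]; last exact: pd.
apply: derivable_within_continuous => x _.
exact: (@ex_derive _ _ _ _ _ _ _ (pd x)).
Qed.

(** Taylor's lower bound in sign form: by the mean value theorem from [a], each [F k x] is [F k a]
    plus a nonnegative multiple of a value of [F k.+1]. *)
Lemma deriv_tower_ge0 (R : realType) (n : nat) (a b : R) (F : nat -> R -> R) :
  deriv_tower n a b F -> (forall k, (k < n)%N -> 0 <= F k a) ->
  (forall x, a <= x <= b -> 0 <= F n x) ->
  forall x, a <= x <= b -> 0 <= F 0 x.
Proof.
elim: n F => [|n IHn] F tF Fa Fn x xab; first exact: Fn.
have F1 := IHn (fun k => F k.+1) (fun k => tF k.+1) (fun k => Fa k.+1) Fn.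
have /andP[ax xb] := xab.
move: ax; rewrite le_eqVlt => /predU1P[<-|ax]; first exact: Fa.
have [c [ac cx E]] := deriv_tower_MVT tF (ltn0Sn n) (lexx a) ax xb.
have := Fa _ (ltn0Sn n); move/eqP : E; rewrite subr_eq => /eqP -> F0.
rewrite addr_ge0// mulr_ge0 ?subr_ge0 ?(ltW ax)//.
by apply: F1; rewrite (ltW ac) (le_trans (ltW cx) xb).
Qed.

Lemma deriv_tower_homo (R : realType) (n k : nat) (a b : R)
    (F : nat -> R -> R) :
  deriv_tower n a b F -> (k < n)%N ->
  (forall x, a <= x <= b -> 0 <= F k.+1 x) ->
  forall x y, a <= x -> x <= y -> y <= b -> F k x <= F k y.
Proof.
move=> tF kn F1 x y ax; rewrite le_eqVlt => /predU1P[->//|xy] yb.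
have [c [xc cy E]] := deriv_tower_MVT tF kn ax xy yb.
rewrite -subr_ge0 E mulr_ge0 ?subr_ge0 ?(ltW xy)//.
by apply: F1; rewrite (le_trans ax (ltW xc)) (le_trans (ltW cy) yb).
Qed.

(* The mean value theorem between a, x and y transports the sign pattern "<= 0
   at a, > 0, then <= 0" from [F 0] to [F 1]. *)
Lemma deriv_tower_gt0_after (R : realType) (n : nat) (a b : R)
    (F : nat -> R -> R) :
  deriv_tower n a b F -> (forall k, (k < n)%N -> F k a <= 0) ->
  (forall x y, a <= x -> x <= y -> y <= b -> F n x <= F n y) ->
  forall x y, a <= x -> x < y -> y <= b -> 0 < F 0 x -> 0 < F 0 y.
Proof.
elim: n F => [|n IHn] F tF Fa Fn x y ax xy yb Fx.
  by apply: lt_le_trans Fx _; apply: Fn => //; exact: ltW.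
have F1 := IHn (fun k => F k.+1) (fun k => tF k.+1) (fun k => Fa k.+1) Fn.
have {}ax : a < x.
  rewrite lt_neqAle ax andbT; apply: contraTneq Fx => <-.
  by rewrite -leNgt Fa.
have [c [ac cx Ec]] :=
  deriv_tower_MVT tF (ltn0Sn n) (lexx a) ax (le_trans (ltW xy) yb).
have [d [xd dy Ed]] := deriv_tower_MVT tF (ltn0Sn n) (ltW ax) xy yb.
rewrite ltNge; apply/negP => Fy.
have Fc : 0 < F 1%N c.
  have := Fa _ (ltn0Sn n); rewrite -(pmulr_lgt0 _ (_ : 0 < x - a)) ?subr_gt0//.
  by rewrite -Ec; lra.
have : 0 < F 1%N d by apply: (F1 c d); lra.
have : F 1%N d * (y - x) < 0 by rewrite -Ed; lra.
by rewrite pmulr_llt0 ?subr_gt0// => /lt_trans /[apply]; rewrite ltxx.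
Qed.

(** With the opposite sign at [a], one more sign change is needed. If [F 0] were nonpositive at [z],
    the mean value theorem on the three gaps would give [F 1] values that are nonpositive, positive,
    negative in turn: the same forbidden pattern one order higher. *)
Lemma deriv_tower_gt0_after_npos (R : realType) (n : nat) (a b : R)
    (F : nat -> R -> R) :
  deriv_tower n a b F -> (forall k, (k < n)%N -> 0 <= F k a) ->
  (forall x y, a <= x -> x <= y -> y <= b -> F n x <= F n y) ->
  forall x y z, a < x -> x < y -> y < z -> z <= b ->
    F 0 x <= 0 -> 0 < F 0 y -> 0 < F 0 z.
Proof.
elim: n F => [|n IHn] F tF Fa Fn x y z ax xy yz zb Fx Fy.
  by apply: lt_le_trans Fy _; apply: Fn => //; lra.
have F1 := IHn (fun k => F k.+1) (fun k => tF k.+1) (fun k => Fa k.+1) Fn.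
have [xb yb ay] : [/\ x <= b, y <= b & a <= y] by split; lra.
have [c [ac cx Ec]] := deriv_tower_MVT tF (ltn0Sn n) (lexx a) ax xb.
have [d [xd dy Ed]] := deriv_tower_MVT tF (ltn0Sn n) (ltW ax) xy yb.
have [e [ye ez Ee]] := deriv_tower_MVT tF (ltn0Sn n) ay yz zb.
rewrite ltNge; apply/negP => Fz.
have Fc : F 1%N c <= 0.
  have := Fa _ (ltn0Sn n); rewrite -(pmulr_lle0 _ (_ : 0 < x - a)) ?subr_gt0//.
  by rewrite -Ec; lra.
have Fd : 0 < F 1%N d.
  by rewrite -(pmulr_lgt0 _ (_ : 0 < y - x)) ?subr_gt0// -Ed; lra.
have : 0 < F 1%N e by apply: (F1 c d e); lra.
have : F 1%N e * (z - y) < 0 by rewrite -Ee; lra.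
by rewrite pmulr_llt0 ?subr_gt0// => /lt_trans /[apply]; rewrite ltxx.
Qed.

(** * Nonnegative derivatives: flatness at 0 and the two comparisons *)

(** Absolute monotonicity of finite order; going up to order [n.+1] makes [h n] nondecreasing. *)
Definition abs_monotone (R : realType) (n : nat) (l : R)
    (h : nat -> R -> R) : Prop :=
  [/\ deriv_tower n.+1 0 l h, h 0 0 = 0 &
      forall k x, (k <= n.+1)%N -> 0 <= x <= l -> 0 <= h k x].

Lemma deriv_tower_sub_pow (R : realType) (n : nat) (l c r : R)
    (h : nat -> R -> R) :
  abs_monotone n l h -> 0 <= r ->
  deriv_tower n r l (fun k x => h k x - c * (n ^_ k)%:R * (x - r) ^+ (n - k)).
Proof.
move=> [th _ _] r0; apply: deriv_tower_sub; last exact: deriv_tower_pow.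
by move=> k kn; apply: (deriv_tower_itvW r0 (lexx l) th); exact: ltnW.
Qed.

Lemma abs_monotone_sub_pow_homo (R : realType) (n : nat) (l c r : R)
    (h : nat -> R -> R) :
  abs_monotone n l h -> 0 <= r ->
  forall x y, r <= x -> x <= y -> y <= l ->
    h n x - c * (n ^_ n)%:R * (x - r) ^+ (n - n) <=
    h n y - c * (n ^_ n)%:R * (y - r) ^+ (n - n).
Proof.
move=> [th _ h0] r0 x y rx xy yl; rewrite subnn !expr0 lerD2r.
apply: (deriv_tower_homo th) => // [z zl|]; first exact: h0.
exact: le_trans rx.
Qed.

Lemma abs_monotone_flat (R : realType) (n : nat) (l c : R)
    (h : nat -> R -> R) :
  abs_monotone n l h -> 0 < l ->
  (forall x, 0 <= x <= l -> h 0 x <= c * x ^+ n) ->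
  forall k, (k < n)%N -> h k 0 = 0.
Proof.
move=> [th _ h0] l0 hc k kn.
have hk0 : 0 <= h k 0 by apply: h0; [exact/ltnW/ltnW|rewrite lexx ltW].
have ltk j : (j < k)%N -> (j < n.+1)%N by move=> /ltn_trans -> //; exact: ltnW.
(* The Taylor coefficient of order [k]: the k-th derivative of [h 0 x - d * x ^+ k] is
   [h k x - h k 0], nonnegative by monotonicity. *)
set d := h k 0 / k`!%:R.
have hlow x : 0 <= x <= l -> d * x ^+ k <= h 0 x.
  move=> xl; rewrite -subr_ge0.
  have tk : deriv_tower k 0 l
      (fun j x => h j x - d * (k ^_ j)%:R * (x - 0) ^+ (k - j)).
    apply: deriv_tower_sub; last exact: deriv_tower_pow.
    by move=> j jk; apply: th; exact: ltk.
  suff : 0 <= h 0 x - d * (k ^_ 0)%:R * (x - 0) ^+ (k - 0).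
    by rewrite ffactn0 mulr1 subn0 subr0.
  apply: (deriv_tower_ge0 tk) => //.
  - move=> j jk; rewrite subrr expr0n subn_eq0 leqNgt jk mulr0 subr0.
    by apply: h0; [exact/ltnW/ltk|rewrite lexx ltW].
  - move=> y /andP[y0 yl]; rewrite subnn expr0 mulr1 ffactnn.
    rewrite divfK ?pnatr_eq0 -?lt0n ?fact_gt0// subr_ge0.
    apply: (deriv_tower_homo th) => //; first exact: ltnW.
    by move=> z zl; apply: h0 => //; exact: leqW.
(* Dividing [d * x ^+ k <= c * x ^+ n] by [x ^+ k] leaves a factor at most [x], because [k < n] and
   [x <= 1]. *)
have dle x : 0 < x -> x <= l -> x <= 1 -> d <= `|c| * x.
  move=> x0 xl x1; have xk : 0 < x ^+ k by rewrite exprn_gt0.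
  rewrite -(ler_pM2r xk); apply: le_trans (hlow _ _) _; first by rewrite ltW.
  apply: le_trans (hc _ _) _; first by rewrite ltW.
  apply: (@le_trans _ _ (`|c| * x ^+ n)).
    by rewrite ler_wpM2r ?ler_norm// exprn_ge0// ltW.
  rewrite -mulrA ler_wpM2l// -exprS.
  by rewrite ler_wiXn2l// ltW.
have d0 : d <= 0.
  apply/ler_addgt0Pr => e e0; rewrite add0r.
  have [m [m0 ml m1 me]] : exists m, [/\ 0 < m, m <= l, m <= 1 & `|c| * m <= e].
    (* The added 1 keeps the denominator positive even when [c] is 0. *)
    exists (Num.min (Num.min l 1) (e / (`|c| + 1))).
    have c1 : 0 < `|c| + 1 by rewrite ltr_wpDl.
    split.
    - by rewrite !lt_min l0 ltr01 divr_gt0.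
    - by rewrite !ge_min lexx.
    - by rewrite !ge_min lexx !orbT.
    - apply: (@le_trans _ _ (`|c| * (e / (`|c| + 1)))).
        by rewrite ler_wpM2l// ge_min lexx orbT.
      by rewrite mulrA ler_pdivrMr// mulrDr mulr1 (mulrC e) lerDl ltW.
  exact: le_trans (dle m m0 ml m1) me.
apply/eqP; rewrite eq_le hk0 andbT.
by move: d0; rewrite /d pmulr_lle0// invr_gt0 ltr0n fact_gt0.
Qed.

Lemma flat_comp_root_convex (R : realType) (n : nat) (l x y z t : R)
    (h : nat -> R -> R) :
  abs_monotone n l h -> (0 < n)%N -> (forall k, (k < n)%N -> h k 0 = 0) ->
  0 <= x -> x < y -> y < z -> z <= l ->
  y ^+ n = t * x ^+ n + (1 - t) * z ^+ n ->
  h 0 y <= t * h 0 x + (1 - t) * h 0 z.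
Proof.
move=> hm n0 hflat x0 xy yz zl yt.
have xzn : 0 < z ^+ n - x ^+ n.
  by rewrite subr_gt0 ltrXn2r -?lt0n// (lt_trans xy).
(* The slope of the chord in the variable [s ^+ n], so that [F 0] takes equal values at [x] and [z];
   the claim becomes [F 0 y <= F 0 x]. *)
pose c := (h 0 z - h 0 x) / (z ^+ n - x ^+ n).
pose F k s := h k s - c * (n ^_ k)%:R * (s - 0) ^+ (n - k).
have tF : deriv_tower n 0 l F by exact: deriv_tower_sub_pow.
have FnE : forall s t, 0 <= s -> s <= t -> t <= l -> F n s <= F n t.
  exact: abs_monotone_sub_pow_homo.
have F0E s : F 0 s = h 0 s - c * s ^+ n.
  by rewrite /F ffactn0 mulr1 subn0 subr0.
have cE : c * (z ^+ n - x ^+ n) = h 0 z - h 0 x by rewrite mulfVK// gt_eqF.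
have Fxz : F 0 z = F 0 x by rewrite !F0E; lra.
have [Fyx|Fyx] := leP (F 0 y) (F 0 x).
  move: Fyx; rewrite !F0E yt => Fyx; move: cE Fyx.
  have -> : c * (t * x ^+ n + (1 - t) * z ^+ n) =
    c * x ^+ n + (1 - t) * (c * (z ^+ n - x ^+ n)) by ring.
  by move=> ->; lra.
have yl : y <= l by lra.
have [p [xp py Ep]] := deriv_tower_MVT tF n0 x0 xy yl.
have y0 : 0 <= y by lra.
have [q [yq qz Eq]] := deriv_tower_MVT tF n0 y0 yz zl.
have Fp : 0 < F 1%N p.
  by rewrite -(pmulr_lgt0 _ (_ : 0 < y - x)) ?subr_gt0// -Ep; lra.
have Fq : F 1%N q < 0.
  by rewrite -(pmulr_llt0 _ (_ : 0 < z - y)) ?subr_gt0// -Eq; lra.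
(* Flatness makes all derivatives of [F] of order 1 to [n.-1] vanish at 0, so the sign lemma applies
   to the shifted family and forbids [F 1] to go from positive at [p] to negative at [q]. *)
have tF' : deriv_tower n.-1 0 l (fun k => F k.+1).
  by move=> k; rewrite ltn_predRL; exact: tF.
suff : 0 < F 1%N q by lra.
apply: (deriv_tower_gt0_after tF' _ _ (x := p)); rewrite ?prednK//; try lra.
move=> k; rewrite ltn_predRL => kn'.
by rewrite /F hflat// subr0 expr0n subn_eq0 leqNgt kn' mulr0 subr0.
Qed.

(* u > 0 keeps the zero r of the interpolating line strictly to the left of x,
   so that the difference with h is nonpositive at a point after r. *)
Lemma flat_root_le_chord (R : realType) (n : nat) (l x y z u v : R)
    (h : nat -> R -> R) :
  abs_monotone n l h -> (0 < n)%N -> (forall k, (k < n)%N -> h k 0 = 0) ->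
  0 <= x -> x < y -> y < z -> z <= l ->
  0 < u -> 0 <= v -> h 0 x <= u ^+ n -> h 0 z <= v ^+ n ->
  h 0 y <= (u + (v - u) / (z - x) * (y - x)) ^+ n.
Proof.
move=> hm n0 hflat x0 xy yz zl u0 v0 hu hv.
have [th h00 hge] := hm.
have hyz : h 0 y <= h 0 z.
  apply: (deriv_tower_homo th) => //; [|lra|lra].
  by move=> s sl; exact: hge.
set s := (v - u) / (z - x).
have sE : s * (z - x) = v - u.
  by rewrite mulfVK// subr_eq0 gt_eqF// (lt_trans xy).
(* When the line does not increase, its value at [y] is at least [v], and monotonicity of [h 0]
   suffices. *)
have [vu|uv] := leP v u.
  have syx : s * (z - x) <= s * (y - x).
    rewrite ler_wnM2l//; last by lra.
    by rewrite /s pmulr_lle0 ?invr_gt0; lra.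
  apply: (le_trans hyz); apply: (le_trans hv).
  by apply: lerXn2r; rewrite ?nnegrE//; lra.
have s0 : 0 < s by rewrite divr_gt0; lra.
pose r := x - u / s.
have usE : s * (u / s) = u by rewrite mulrCA divff ?mulr1// gt_eqF.
have lineE w : u + s * (w - x) = s * (w - r).
  by rewrite /r; rewrite -[in LHS]usE; ring.
have us0 : 0 < u / s by rewrite divr_gt0.
have vE : v = s * (z - r) by rewrite -lineE; lra.
have rx : r < x by rewrite /r; lra.
clearbody r; clearbody s; rewrite lineE.
(* If [r <= 0], the line is replaced by the one through the origin with value [v] at [z], which lies
   below it at [y]; the comparison then starts at 0, where flatness gives the initial values. *)
have [r0|r0] := leP r 0.
  pose c := h 0 z / z ^+ n.
  have z0 : 0 < z by lra.
  have zn0 : 0 < z ^+ n by rewrite exprn_gt0.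
  pose F k w := h k w - c * (n ^_ k)%:R * (w - 0) ^+ (n - k).
  have tF : deriv_tower n 0 l F by exact: deriv_tower_sub_pow.
  have F0E w : F 0 w = h 0 w - c * w ^+ n.
    by rewrite /F ffactn0 mulr1 subn0 subr0.
  have Fy : F 0 y <= 0.
    rewrite leNgt; apply/negP => Fy.
    suff : 0 < F 0 z by rewrite F0E mulfVK ?subrr ?ltxx// gt_eqF.
    apply: (deriv_tower_gt0_after tF _ _ (x := y)) => //; last 2 first.
    - exact: abs_monotone_sub_pow_homo.
    - lra.
    move=> k kn; rewrite /F hflat// subr0 expr0n subn_eq0 leqNgt kn.
    by rewrite mulr0 subr0.
  move: Fy; rewrite F0E subr_le0 => /le_trans; apply.
  apply: (@le_trans _ _ ((v / z * y) ^+ n)).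
    rewrite exprMn expr_div_n /c ler_wpM2r ?exprn_ge0//; first lra.
    by rewrite ler_wpM2r// invr_ge0 ltW.
  apply: lerXn2r; rewrite ?nnegrE.
  - by rewrite mulr_ge0 ?divr_ge0//; lra.
  - by rewrite mulr_ge0//; lra.
  - rewrite vE mulrAC ler_pdivrMr// -!mulrA ler_pM2l//.
    have : r * z <= r * y by rewrite ler_wnM2l//; lra.
    lra.
(* For [r > 0] the comparison starts at [r], where the power has vanishing derivatives below order
   [n], so the initial values are those of [h] and hence nonnegative. *)
pose F k w := h k w - s ^+ n * (n ^_ k)%:R * (w - r) ^+ (n - k).
have tF : deriv_tower n r l F by apply: deriv_tower_sub_pow => //; exact: ltW.
have F0E w : F 0 w = h 0 w - (s * (w - r)) ^+ n.
  by rewrite /F ffactn0 mulr1 subn0 exprMn.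
rewrite -subr_le0 -F0E leNgt; apply/negP => Fy.
suff : 0 < F 0 z by rewrite F0E -vE; lra.
apply: (deriv_tower_gt0_after_npos tF _ _ (x := x) (y := y)) => //.
- move=> k kn; rewrite /F subrr expr0n subn_eq0 leqNgt kn mulr0 subr0.
  by apply: hge; [exact/ltnW/ltnW|lra].
- by apply: abs_monotone_sub_pow_homo => //; exact: ltW.
- by rewrite F0E -lineE subrr mulr0 addr0; lra.
Qed.

(** * Convexity inequalities and nth roots *)

Lemma convex_function_lt (R : realType) (D : set R) (f : R -> R) :
  (forall x y t, D x -> D y -> x < y -> 0 < t < 1 ->
    f (t * x + (1 - t) * y) <= t * f x + (1 - t) * f y) ->
  convex_function D f.
Proof.
move=> cf t x y /[!inE] Dx Dy.
change (f (t%:num * x + (1 - t%:num) * y) <=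
        t%:num * f x + (1 - t%:num) * f y).
have s0 : 0 <= t%:num by [].
have s1 : t%:num <= 1 by [].
move: t%:num s0 s1 => s s0 s1.
have [->|sn0] := eqVneq s 0; first by rewrite !mul0r !add0r subr0 !mul1r.
have [->|sn1] := eqVneq s 1; first by rewrite subrr !mul0r !addr0 !mul1r.
have {}s0 : 0 < s by rewrite lt_neqAle eq_sym sn0.
have {}s1 : s < 1 by rewrite lt_neqAle sn1.
have [xy|yx|->] := ltgtP x y; first by apply: cf => //; rewrite s0.
- have E (u v : R) : s * u + (1 - s) * v = (1 - s) * v + (1 - (1 - s)) * u.
    by ring.
  by rewrite !E; apply: cf => //; lra.
- by rewrite -!mulrDl addrCA subrr addr0 !mul1r.
Qed.

Lemma convex_function_le (R : realType) (D : set R) (f : R -> R) (x y t : R) :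
  convex_function D f -> D x -> D y -> 0 <= t <= 1 ->
  f (t * x + (1 - t) * y) <= t * f x + (1 - t) * f y.
Proof.
move=> cf Dx Dy t01.
have t01' : Itv.spec (@Itv.num_sem R) (Itv.Real `[0%Z, 1%Z]) t.
  by rewrite /= /Itv.num_sem /= in_itv /= t01 ger0_real//; case/andP: t01.
have := cf (Itv.mk t01') x y (mem_set Dx) (mem_set Dy).
by [].
Qed.

Lemma powR_invnK (R : realType) (n : nat) (x : R) :
  (0 < n)%N -> 0 <= x -> (x `^ (1 / n%:R)) ^+ n = x.
Proof.
move=> n0 x0; rewrite -powR_mulrn ?powR_ge0// -powRrM.
by rewrite mul1r mulVf ?powRr1// pnatr_eq0 -lt0n.
Qed.

Lemma powR_exprnK (R : realType) (n : nat) (x : R) :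
  (0 < n)%N -> 0 <= x -> (x ^+ n) `^ (1 / n%:R) = x.
Proof.
move=> n0 x0; rewrite -powR_mulrn// -powRrM.
by rewrite mul1r mulfV ?powRr1// pnatr_eq0 -lt0n.
Qed.

(** * The reflected function and its derivatives *)

(** The k-th derivative of [f b - f (b - t)] in [t]: each differentiation of [b - t] contributes a
    sign, and the constant [f b] survives only at order 0. *)
Definition reflected (R : realType) (a b : R) (f : R -> R)
    (k : nat) (t : R) : R :=
  (-1) ^+ k.+1 * derive_itvn a b k f (b - t) + (if k is 0 then f b else 0).

Lemma reflected0 (R : realType) (a b : R) (f : R -> R) (t : R) :
  reflected a b f 0 t = f b - f (b - t).
Proof. by rewrite /reflected expr1 mulN1r addrC. Qed.

Lemma deriv_tower_reflected (R : realType) (m : nat) (a b : R) (f : R -> R) :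
  Cm_itv m a b f -> deriv_tower m 0 (b - a) (reflected a b f).
Proof.
move=> [df _] k km; split.
  apply/subspace_continuousP => t /=; rewrite in_itv/= => /andP[t0 tba].
  have btab : b - t \in `[a, b] by rewrite in_itv/=; apply/andP; split; lra.
  rewrite /reflected; apply: cvgD; last exact: cvg_cst.
  apply: cvgM; first exact: cvg_cst.
  apply: (cvg_comp (fun s => b - s) _ _
            (derivable_itv_continuous (df _ km _ btab))).
  have refl_cvg : b - s @[s --> t] --> b - t.
    by apply: cvgB; [exact: cvg_cst|exact: cvg_id].
  (* The reflection carries the trace of a neighbourhood on [[0, b - a]] to one on [[a, b]], which
     covers the endpoints too. *)
  move=> A Abt.
  change (nbhs t (fun s => `[0, b - a]%classic s -> A (b - s))).
  apply: (@filterS _ (nbhs t) _ _ _ _ (refl_cvg _ Abt)) => s /= As.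
  rewrite in_itv/= => /andP[s0 sba].
  by apply: As; rewrite in_itv/=; apply/andP; split; lra.
move=> t; rewrite in_itv/= => /andP[t0 tba].
have btab : b - t \in `]a, b[ by rewrite in_itv/=; apply/andP; split; lra.
have dfk := derivable_itv_is_derive btab (df _ km _ (subset_itv_oo_cc btab)).
have drefl : is_derive t 1 (fun s : R => b - s) (0 - 1) by apply: is_deriveB.
have dcomp := @is_derive1_comp R _ (fun s => b - s) t _ _ dfk drefl.
have -> : reflected a b f k.+1 t =
    (-1) ^+ k.+1 * (derive_itvn a b k.+1 f (b - t) * (0 - 1)) + 0.
  by rewrite /reflected sub0r exprS; ring.
exact: is_deriveD.
Qed.

(** The reflection turns the alternating signs of [f] into nonnegativity at orders 1 to [n.+1];
    order 0 follows by monotonicity from the value 0 at 0. *)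
Lemma U_itv_abs_monotone (R : realType) (n : nat) (a b : R) (f : R -> R) :
  a < b -> U_itv n a b f -> abs_monotone n (b - a) (reflected a b f).
Proof.
move=> ab [fC fs].
have tf := deriv_tower_reflected fC.
have pos k t : (k <= n)%N -> 0 <= t <= b - a -> 0 <= reflected a b f k.+1 t.
  move=> kn /andP[t0 tba]; rewrite /reflected addr0 exprS mulN1r mulNr oppr_ge0.
  by apply: fs => //; rewrite in_itv/=; apply/andP; split; lra.
have r00 : reflected a b f 0 0 = 0 by rewrite reflected0 subr0 subrr.
split=> // -[|k] t kn tba; last exact: pos.
rewrite -r00; case/andP: tba => t0 tba.
by apply: (deriv_tower_homo tf) => // s sba; exact: pos.
Qed.

(** * Flatness against each of the two convexity properties *)

Lemma flat_powR_convex (R : realType) (n : nat) (a b : R) (f : R -> R)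
    (h := reflected a b f) :
  a < b -> (0 < n)%N -> abs_monotone n (b - a) h ->
  (forall k, (k < n)%N -> h k 0 = 0) ->
  convex_function (`[a, b] : set R)
    (fun x : R => (f b - f x) `^ (1 / n%:R)).
Proof.
move=> ab n0 hm hflat; have [_ _ hge] := hm.
have fh x : f b - f x = h 0 (b - x) by rewrite /h reflected0 subKr.
apply: convex_function_lt => x y t /=; rewrite !in_itv/=.
move=> /andP[ax xb] /andP[ay yb] xy /andP[t0 t1].
rewrite !fh.
set v := h 0 (b - x) `^ _; set u := h 0 (b - y) `^ _.
(* The chord bound wants a positive value at its left end [b - y], but [u] is 0 when [y = b]; the
   slack [e] repairs this. *)
apply/ler_addgt0Pr => e e0.
have h0 s : a <= s -> s <= b -> 0 <= h 0 (b - s).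
  by move=> ? ?; apply: hge => //; lra.
have v0 : 0 <= v := powR_ge0 _ _.
have u0 : 0 <= u := powR_ge0 _ _.
have ue0 : 0 < u + e by lra.
have hu : h 0 (b - y) <= (u + e) ^+ n.
  rewrite -[leLHS](powR_invnK n0); last exact: h0.
  by rewrite -/u; apply: lerXn2r; rewrite ?nnegrE//; lra.
have hv : h 0 (b - x) <= v ^+ n by rewrite powR_invnK// h0.
have txy : 0 < t * (y - x) by rewrite mulr_gt0; lra.
have sxy : 0 < (1 - t) * (y - x) by rewrite mulr_gt0; lra.
have [m0 m1 m2 m3] : [/\ 0 <= b - y, b - y < b - (t * x + (1 - t) * y),
    b - (t * x + (1 - t) * y) < b - x & b - x <= b - a].
  by split; lra.
have := flat_root_le_chord hm n0 hflat m0 m1 m2 m3 ue0 v0 hu hv.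
have -> : u + e + (v - (u + e)) / (b - x - (b - y)) *
    (b - (t * x + (1 - t) * y) - (b - y)) = t * v + (1 - t) * (u + e).
  by field; rewrite gt_eqF; lra.
move=> hchord.
have w0 : 0 <= t * v + (1 - t) * (u + e) by rewrite addr_ge0 ?mulr_ge0//; lra.
have := ge0_ler_powR (_ : 0 <= 1 / n%:R) _ _ hchord.
rewrite powR_exprnK// !nnegrE => /(_ _ _ _)/le_trans; apply.
- by rewrite divr_ge0.
- by apply: hge => //; lra.
- by rewrite exprn_ge0.
- nra.
Qed.

Lemma powR_convex_flat (R : realType) (n : nat) (a b : R) (f : R -> R)
    (h := reflected a b f) :
  a < b -> (0 < n)%N -> abs_monotone n (b - a) h ->
  convex_function (`[a, b] : set R)
    (fun x : R => (f b - f x) `^ (1 / n%:R)) ->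
  forall k, (k < n)%N -> h k 0 = 0.
Proof.
move=> ab n0 hm cg; have [_ _ hge] := hm.
have ba : 0 < b - a by lra.
have fh x : f b - f (b - x) = h 0 x by rewrite /h reflected0.
(* The bound comes from the chord between [b], where the root is 0, and [a]; its nth power has this
   constant. *)
apply: (abs_monotone_flat (c := h 0 (b - a) / (b - a) ^+ n) hm ba) => x xba.
have /andP[x0 xl] := xba.
have t01 : 0 <= x / (b - a) <= 1.
  by rewrite divr_ge0 ?(ltW ba)//= ler_pdivrMr// mul1r.
have Da : `[a, b]%classic a by rewrite /= in_itv/= lexx ltW.
have Db : `[a, b]%classic b by rewrite /= in_itv/= lexx ltW.
have := convex_function_le cg Da Db t01.
have -> : x / (b - a) * a + (1 - x / (b - a)) * b = b - x.
  by field; rewrite gt_eqF.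
rewrite subrr powR0; last by rewrite mul1r invr_eq0 pnatr_eq0 -lt0n.
rewrite mulr0 addr0 fh -[in f a](subKr b a) fh => hx.
rewrite -[leLHS](powR_invnK n0); last exact: hge.
apply: (@le_trans _ _ ((x / (b - a) * h 0 (b - a) `^ (1 / n%:R)) ^+ n)).
  apply: lerXn2r => //; rewrite nnegrE ?powR_ge0// mulr_ge0 ?powR_ge0//.
  by case/andP: t01.
rewrite exprMn powR_invnK//; last by apply: hge => //; rewrite lexx ltW.
by rewrite expr_div_n -mulrA [leLHS]mulrC [_^-1 * _]mulrC.
Qed.

Lemma flat_comp_powR_convex (R : realType) (n : nat) (a b : R) (f : R -> R)
    (h := reflected a b f) :
  a < b -> (0 < n)%N -> abs_monotone n (b - a) h ->
  (forall k, (k < n)%N -> h k 0 = 0) ->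
  convex_function (`[0, (b - a) ^+ n] : set R)
    (fun x : R => - f (b - x `^ (1 / n%:R))).
Proof.
move=> ab n0 hm hflat.
(* Up to the constant [f b], which cancels in convex combinations, the function is [h 0] composed
   with the nth root. *)
have fh x : - f (b - x) = h 0 x - f b by rewrite /h reflected0; ring.
apply: convex_function_lt => x y t /=; rewrite !in_itv/=.
move=> /andP[x0 xl] /andP[y0 yl] xy /andP[t0 t1].
rewrite !fh.
have root_lt (u v : R) : 0 <= u -> u < v -> u `^ (1 / n%:R) < v `^ (1 / n%:R).
  move=> u0 uv; apply: gt0_ltr_powR; rewrite ?nnegrE//; last lra.
  by rewrite divr_gt0// ltr0n.
set z := t * x + (1 - t) * y.
have txy : 0 < t * (y - x) by rewrite mulr_gt0; lra.
have sxy : 0 < (1 - t) * (y - x) by rewrite mulr_gt0; lra.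
have xz : x < z by rewrite /z; lra.
have zy : z < y by rewrite /z; lra.
have z0 : 0 <= z by lra.
have yba : y `^ (1 / n%:R) <= b - a.
  rewrite -[leRHS](powR_exprnK n0); last lra.
  apply: ge0_ler_powR; rewrite ?nnegrE ?divr_ge0// exprn_ge0//; lra.
have := flat_comp_root_convex hm n0 hflat (powR_ge0 x _) (root_lt _ _ x0 xz)
  (root_lt _ _ z0 zy) yba (t := t).
rewrite !powR_invnK// => /(_ erefl); lra.
Qed.

Lemma comp_powR_convex_flat (R : realType) (n : nat) (a b : R) (f : R -> R)
    (h := reflected a b f) :
  a < b -> (0 < n)%N -> abs_monotone n (b - a) h ->
  convex_function (`[0, (b - a) ^+ n] : set R)
    (fun x : R => - f (b - x `^ (1 / n%:R))) ->
  forall k, (k < n)%N -> h k 0 = 0.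
Proof.
move=> ab n0 hm ck; have [_ h00 hge] := hm.
have ba : 0 < b - a by lra.
have fh x : - f (b - x) = h 0 x - f b by rewrite /h reflected0; ring.
have ln0 : 0 < (b - a) ^+ n by rewrite exprn_gt0.
apply: (abs_monotone_flat (c := h 0 (b - a) / (b - a) ^+ n) hm ba) => x xba.
have /andP[x0 xl] := xba.
(* The weight that places [x ^+ n] on the chord from 0 to [(b - a) ^+ n]. *)
have t01 : 0 <= x ^+ n / (b - a) ^+ n <= 1.
  rewrite divr_ge0 ?exprn_ge0 ?(ltW ba)//= ler_pdivrMr// mul1r.
  by rewrite lerXn2r ?nnegrE// ltW.
have Dl : `[0, (b - a) ^+ n]%classic ((b - a) ^+ n).
  by rewrite /= in_itv/= lexx ltW.
have D0 : `[0, (b - a) ^+ n]%classic (0 : R) by rewrite /= in_itv/= lexx ltW.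
have := convex_function_le ck Dl D0 t01.
rewrite mulr0 addr0 divfK ?gt_eqF// !fh !powR_exprnK ?(ltW ba)//.
rewrite powR0; last by rewrite mul1r invr_eq0 pnatr_eq0 -lt0n.
by rewrite [h 0 0]h00; lra.
Qed.

Theorem corollary2 (R : realType) (a b : R) (n : nat) (f : R -> R)
  (hab : a < b) (hn : (0 < n)%N) (hf : U_itv n a b f) :
  convex_function (`[a, b] : set R)
    (fun x : R => (f b - f x) `^ (1 / n%:R)) <->
  convex_function (`[0, (b - a) ^+ n] : set R)
    (fun x : R => - f (b - x `^ (1 / n%:R))).
Proof.
have hm := U_itv_abs_monotone hab hf; split=> [cg|ck].
- exact: flat_comp_powR_convex (powR_convex_flat hab hn hm cg).
- exact: flat_powR_convex (comp_powR_convex_flat hab hn hm ck).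
Qed.
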